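(* Let $T$ be a closed densely defined operator in $\mathfrak H$. Then $T\in\mathcal L_l^{+2}(\mathfrak H)$ if and only if $T^*T\le T^*Y=YT$ admits a solution $Y=Y^*\ge0$ such that $T^*Y$ is selfadjoint and $\mathrm{dom}\,T\subseteq\mathrm{dom}\,Y\subseteq\mathrm{dom}\,(T^*Y)^{1/2}$.
   Context: $\mathfrak H$ is a complex Hilbert space; $B^+(\mathfrak H)$ is the set of bounded everywhere defined nonnegative selfadjoint operators on $\mathfrak H$. $\mathcal L_l^{+2}(\mathfrak H)$ is the class of closed operators $T$ in $\mathfrak H$ of the form $T=AB$ with $A\in B^+(\mathfrak H)$ and $B=B^*\ge0$ (in general unbounded). Products of operators have their natural domains. For nonnegative selfadjoint operators $C,D$, $C\le D$ means $\mathrm{dom}\,D^{1/2}\subseteq\mathrm{dom}\,C^{1/2}$ and $\|C^{1/2}x\|\le\|D^{1/2}x\|$ for all $x\in\mathrm{dom}\,D^{1/2}$; writing such an inequality includes the assertion that both sides are nonnegative and selfadjoint. *)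

(* Defs.v *)
From HB Require Import structures.
From mathcomp Require Import all_boot all_order all_algebra.
From mathcomp Require Import complex.
From mathcomp Require Import all_classical all_reals all_analysis.

Set Implicit Arguments.
Unset Strict Implicit.
Unset Printing Implicit Defensive.

Import Order.TTheory GRing.Theory Num.Theory.
Import numFieldNormedType.Exports.

Local Open Scope classical_set_scope.
Local Open Scope ring_scope.
Local Open Scope complex_scope.

(** The inner product [ip u v] is linear in [u] and conjugate-linear in [v]. *)
HB.mixin Record isHilbert (R : realType) (H : Type)
    of CompleteNormedModule R[i] H := {
  ip : {dot H for (@Num.conj R[i])} ;
  ip_norm : forall x : H, `|x| ^+ 2 = ip x x }.

#[short(type="hilbertType")]
HB.structure Definition Hilbert (R : realType) :=
  { H of isHilbert R H & CompleteNormedModule R[i] H }.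

Section Operators.
Context {R : realType} {H : hilbertType R}.

(** A (possibly unbounded, partially defined) operator is represented by its
    graph, so that equality of graphs is equality of operators, domains
    included: [T (x, y)] reads "[x] is in the domain of [T] and [T x = y]".
    The closedness of an operator is then [closed] for the product topology. *)
Definition linop (T : set (H * H)) : Prop :=
  [/\ T (0, 0),
      forall (a : R[i]) x y x' y',
        T (x, y) -> T (x', y') -> T (a *: x + x', a *: y + y')
    & forall x y y', T (x, y) -> T (x, y') -> y = y'].

Definition dom (T : set (H * H)) : set H := [set x | exists y, T (x, y)].

(** [opmul S T] is the product [S T] (first [T], then [S]), on its natural
    domain. *)
Definition opmul (S T : set (H * H)) : set (H * H) :=
  [set p | exists2 y, T (p.1, y) & S (y, p.2)].

(** If [T] is not densely defined, this is only a linear relation. *)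
Definition adj (T : set (H * H)) : set (H * H) :=
  [set p | forall x y, T (x, y) -> ip y p.1 = ip x p.2].

Definition selfadjoint (A : set (H * H)) : Prop :=
  [/\ linop A, dense (dom A) & adj A = A].

(** In the order of [R[i]], [0 <= z] means that [z] is real and nonnegative. *)
Definition nonneg (A : set (H * H)) : Prop :=
  forall x y, A (x, y) -> 0 <= ip y x.

Definition nonneg_selfadjoint (A : set (H * H)) : Prop :=
  selfadjoint A /\ nonneg A.

Definition bounded_op (A : set (H * H)) : Prop :=
  exists M : R, forall x y, A (x, y) -> `|y| <= M%:C * `|x|.

Definition Bplus : set (set (H * H)) :=
  [set A | [/\ nonneg_selfadjoint A, dom A = setT & bounded_op A]].

Definition Ll2plus : set (set (H * H)) :=
  [set T | [/\ linop T, closed T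
    & exists A B, [/\ Bplus A, nonneg_selfadjoint B & T = opmul A B]]].

(** [opsqrt C] is the nonnegative selfadjoint square root of [C]. It is only
    used for [C] nonnegative selfadjoint, in which case it is unique. The
    default value [set0] is not the graph of an operator. *)
Definition opsqrt (C : set (H * H)) : set (H * H) :=
  xget set0 [set S | nonneg_selfadjoint S /\ opmul S S = C].

Definition ople (C D : set (H * H)) : Prop :=
  [/\ nonneg_selfadjoint C, nonneg_selfadjoint D,
      dom (opsqrt D) `<=` dom (opsqrt C)
    & forall x u v, opsqrt C (x, u) -> opsqrt D (x, v) -> `|u| <= `|v|].

End Operators.

(* Main.v *)
Require Import Defs.
From mathcomp Require Import all_boot all_order all_algebra.
From mathcomp Require Import complex ring lra.
From mathcomp Require Import all_classical all_reals all_analysis.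

(** Let T = A B with A bounded and nonnegative, B nonnegative selfadjoint.
    Moving a positive scalar from A to B, assume that A is a contraction; then
    Y = B solves the inequality.  Since A is bounded, adj T = B A, so that
    adj T Y = B A B = Y T.  Put C = A^(1/2) B.  This operator is closed
    because T is, its adjoint is B A^(1/2), and B A B = adj C C; hence B A B is
    nonnegative selfadjoint by the theorem of von Neumann
    ([adjmul_selfadjoint]) and its square root has the domain of C, which is
    dom B = dom T, and the norms of C ([opsqrt_polar]).  The inequality
    adj T T <= adj T Y then reads |A^(1/2) C x| <= |C x|.

    Conversely let S be the square root of adj T Y = Y T.  The inequality
    between the operators and the inclusions between the domains give
    dom T = dom Y = dom S and |T x| <= |S x|, so V : S x |-> T x is a
    contraction, defined on the closure of the range of S.  For x in the domain
    of S S = Y T one has <T x, Y u> = <Y T x, u> = <S x, S u>; as this domain is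
    a core of S ([adjmul_core]) and T is dominated by S, the identity
    <T x, Y u> = <S x, S u> holds on all of dom T.  It says that
    adj V (Y u) = S u, whence V (adj V) Y u = V S u = T u: thus T = A Y with
    A = V (adj V) bounded and nonnegative.

    The operator theory behind both arguments rests on one variational
    principle, [approximate_riesz]: on a linear subspace of a semi-inner
    product space a bounded linear functional is represented by a Cauchy
    minimizing sequence.  In the graph of T it gives that 1 + adj T T is onto,
    from which come the selfadjointness of adj T T, its bounded resolvent g and
    the core property; on the range of S it gives adj V.  Square roots of
    bounded operators are limits of the iteration w |-> (b + w^2) / 2
    ([bounded_sqrt_exists]), and the square root of adj T T is built from those
    of g and 1 - g ([sqrt_exists]). *)

Set Implicit Arguments.
Unset Strict Implicit.
Unset Printing Implicit Defensive.

Import Order.TTheory GRing.Theory Num.Theory.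
Import numFieldNormedType.Exports.

Local Open Scope classical_set_scope.
Local Open Scope ring_scope.

Local Notation Re := complex.Re.

(** * Minimization in pre-Hilbert spaces *)

Section PreHilbert.
Context {R : realType}.
Local Notation C := R[i]%C.
Implicit Types (a z : C) (s : R).

Lemma ge0_complexE z : 0 <= z -> z = ((Re z)%:C)%C.
Proof. by move=> h; rewrite RRe_real// ger0_real. Qed.

Lemma Re_ge0 z : 0 <= z -> 0 <= Re z.
Proof. by rewrite lecE => /andP[]. Qed.

Lemma Re_realM s z : Re ((s%:C)%C * z) = s * Re z.
Proof. by case: z => x y /=; rewrite mul0r subr0. Qed.

Lemma Re_conj z : Re (z^*) = Re z.
Proof. by case: z. Qed.

Lemma Re_mulCC z : Re (z^* * z) = Re (`|z| ^+ 2).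
Proof. by rewrite mulrC normCK. Qed.

Lemma Re_sqr_le_norm z : Re z ^+ 2 <= Re (`|z| ^+ 2).
Proof.
by rewrite -add_Re2_Im2 /= lerDl sqr_ge0.
Qed.

Lemma Re_normM a z : Re (`|a * z| ^+ 2) = Re (`|a| ^+ 2) * Re (`|z| ^+ 2).
Proof.
rewrite normrM exprMn (@ge0_complexE (`|a| ^+ 2)) ?exprn_ge0//.
by rewrite Re_realM.
Qed.

(** Discriminant inequality: testing with [a = - s z^*], [s] real, leaves the
    real quadratic [e + s^2 |z|^2 b - 2 s |z|^2], and [s = 1 / b] is optimal. It
    yields both the Cauchy-Schwarz inequality and the Euler-Lagrange estimate
    for approximate minimizers. *)
Lemma quadratic_bound (e b : R) z : 0 <= b -> 0 <= e ->
  (forall a, 0 <= e + Re (`|a| ^+ 2) * b + 2 * Re (a * z)) ->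
  Re (`|z| ^+ 2) <= e * b.
Proof.
move=> b0 e0 h; set c := Re _.
have c0 : 0 <= c by rewrite Re_ge0 // exprn_ge0.
have hs s : 0 <= e + s ^+ 2 * c * b - 2 * s * c.
  have := h ((- s)%:C%C * z^*).
  rewrite -mulrA Re_realM Re_mulCC -/c.
  rewrite Re_normM norm_conjC -/c -add_Re2_Im2 /=.
  by lra.
have [b1|b1] := eqVneq b 0.
  rewrite b1 mulr0; have [//|c1] := leP c 0.
  have := hs ((e + 1) / (2 * c)).
  rewrite b1 mulr0 addr0.
  have -> : 2 * ((e + 1) / (2 * c)) * c = e + 1 by field; lra.
  by lra.
have bp : 0 < b by rewrite lt_neqAle eq_sym b1.
have := hs b^-1.
have -> : e + b^-1 ^+ 2 * c * b - 2 * b^-1 * c = (e * b - c) / b by field.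
by rewrite pmulr_lge0 ?invr_gt0// subr_ge0.
Qed.

Variables (E : lmodType C) (B : E -> E -> C).
Hypothesis Blin : forall a x y (w : E), B (a *: x + y) w = a * B x w + B y w.
Hypothesis Bherm : forall x y, B x y = (B y x)^*.
Hypothesis Bpos : forall x, 0 <= B x x.
Local Notation q x := (Re (B x x)).

Let BDl x y w : B (x + y) w = B x w + B y w.
Proof. by rewrite -[x in LHS]scale1r Blin mul1r. Qed.
Let B0l w : B 0 w = 0.
Proof. by apply: (addrI (B 0 w)); rewrite -{1}[B 0 w]mul1r -Blin scaler0 !addr0. Qed.
Let BZl a x w : B (a *: x) w = a * B x w.
Proof. by rewrite -[a *: x]addr0 Blin B0l addr0. Qed.
Let BDr x y w : B x (y + w) = B x y + B x w.
Proof. by rewrite Bherm BDl rmorphD /= -!Bherm. Qed.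
Let BZr a x y : B x (a *: y) = a^* * B x y.
Proof. by rewrite Bherm BZl rmorphM /= -!Bherm. Qed.

Lemma semiip_normD x y : q (x + y) = q x + q y + 2 * Re (B y x).
Proof.
rewrite BDl !BDr [B x y]Bherm !raddfD /= Re_conj; lra.
Qed.

Lemma semiip_normZ a x : q (a *: x) = Re (`|a| ^+ 2) * q x.
Proof.
rewrite BZl BZr mulrA -normCK (@ge0_complexE (`|a| ^+ 2)) ?exprn_ge0//.
by rewrite Re_realM.
Qed.

Lemma semiip_CauchySchwarz x y : Re (`|B x y| ^+ 2) <= q x * q y.
Proof.
rewrite mulrC; apply: quadratic_bound; rewrite ?Re_ge0// => a.
have := Re_ge0 (Bpos (a *: x + y)).
by rewrite [a *: x + y]addrC semiip_normD semiip_normZ BZl.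
Qed.

Variables (M : set E) (f : E -> C) (K : R).
Hypothesis M0 : M 0.
Hypothesis Mlin : forall a x y, M x -> M y -> M (a *: x + y).
Hypothesis flin : forall a x y, f (a *: x + y) = a * f x + f y.
Hypothesis K0 : 0 <= K.
Hypothesis fbound : forall x, M x -> Re (`|f x| ^+ 2) <= K * q x.

(** The functional [J x = B x x - 2 Re (f x)] is bounded below on [M]; take
    [u n] with [J (u n)] within [1 / (n + 1)] of the infimum. The parallelogram
    identity makes [u] Cauchy, and comparing [J (u n)] with [J (u n + a v)] makes
    [B v (u n)] close to [f v]. Since the form may be degenerate and [M] need
    not be complete, the limit is left to the applications. *)
Lemma approximate_riesz : exists u : nat -> E,
  [/\ forall n, M (u n),
      forall n m, q (u n - u m) <= 2 * (n.+1%:R^-1 + m.+1%:R^-1)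
    & forall n v, M v -> Re (`|B v (u n) - f v| ^+ 2) <= n.+1%:R^-1 * q v].
Proof.
pose J x := q x - 2 * Re (f x).
have fD x y : f (x + y) = f x + f y by rewrite -[x in LHS]scale1r flin mul1r.
have f0 : f 0 = 0.
  by apply: (addrI (f 0)); rewrite -{1}[f 0]mul1r -flin scaler0 !addr0.
have fZ a x : f (a *: x) = a * f x by rewrite -[a *: x]addr0 flin f0 addr0.
have JD x y : J (x + y) = J x + q y + 2 * Re (B y x - f y).
  rewrite /J semiip_normD fD !raddfD /= raddfN /=; lra.
have MD x y : M x -> M y -> M (x + y).
  by move=> Mx My; rewrite -[x]scale1r; apply: Mlin.
have MZ a x : M x -> M (a *: x).
  by move=> Mx; rewrite -[a *: x]addr0; apply: Mlin.
have Jlow x : M x -> - K <= J x.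
  move=> Mx; have h := fbound Mx; have h' := Re_sqr_le_norm (f x).
  have qx := Re_ge0 (Bpos x); rewrite /J.
  suff : 2 * Re (f x) <= K + q x by lra.
  rewrite leNgt; apply/negP => lt.
  have := sqr_ge0 (K - q x); move: (q x) (Re (f x)) (Re (`|f x| ^+ 2)) K0 h h' qx lt.
  move=> Q r m K0' h h' Q0 lt sq.
  have : (K + Q) ^+ 2 < (2 * r) ^+ 2 by rewrite ltr_pXn2r ?nnegrE//; lra.
  by lra.
pose S := J @` M.
have Sinf : has_inf S.
  split; first by exists (J 0), 0.
  by exists (- K) => _ [x Mx <-]; apply: Jlow.
have Jge x : M x -> inf S <= J x.
  by move=> Mx; apply: ge_inf; [case: Sinf | exists x].
have ex n : exists x, M x /\ J x <= inf S + n.+1%:R^-1.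
  have e0 : 0 < n.+1%:R^-1 :> R by rewrite invr_gt0.
  have [_ [x Mx <-] lt] := inf_adherent e0 Sinf.
  by exists x; split=> //; exact: ltW.
have [u hu] := choice ex; exists u; split=> [n|n m|n v Mv].
- by case: (hu n).
- have [Mn Jn] := hu n; have [Mm Jm] := hu m.
  pose w := 2^-1 *: (u n - u m).
  have h2 : 2^-1 + 2^-1 = 1 :> C by field.
  (* With [w = (u n - u m) / 2], expanding [J] at [u m], [u m + w] and
     [u m + w + w] is the parallelogram identity. *)
  have e1 : u n - u m = w + w by rewrite -scalerDl h2 scale1r.
  have e2 : u n = (u m + w) + w by rewrite -addrA -e1 addrC subrK.
  have Mw : M w by apply/MZ/MD => //; rewrite -scaleN1r; apply: MZ.
  have := Jge _ (MD _ _ Mm Mw).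
  rewrite e1 semiip_normD.
  move: Jn; rewrite e2 !JD BDr !raddfD /= raddfN/=.
  move: Jm; move: (n.+1%:R^-1) (m.+1%:R^-1) => en em.
  lra.
- have [Mn Jn] := hu n.
  apply: quadratic_bound; rewrite ?Re_ge0 ?invr_ge0// => a.
  have := Jge _ (MD _ _ Mn (MZ a v Mv)).
  rewrite JD semiip_normZ BZl fZ -mulrBr.
  by move: Jn; move: (n.+1%:R^-1) => en; lra.
Qed.

End PreHilbert.

(** * Inner products and sequences *)

Section HilbertSpace.
Context {R : realType} {H : hilbertType R}.
Implicit Types (x y z : H) (a : R[i]%C).

Lemma ipDl x y z : ip (x + y) z = ip x z + ip y z.
Proof. exact: linearDl. Qed.
Lemma ipZl a x z : ip (a *: x) z = a * ip x z.
Proof. exact: linearZl_LR. Qed.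
Lemma ipDr x y z : ip x (y + z) = ip x y + ip x z.
Proof. exact: linearDr. Qed.
Lemma ipBl x y z : ip (x - y) z = ip x z - ip y z.
Proof. exact: linearBl. Qed.
Lemma ipBr x y z : ip x (y - z) = ip x y - ip x z.
Proof. exact: linearBr. Qed.
Lemma ipZr a x z : ip x (a *: z) = a^* * ip x z.
Proof. exact: linearZr_LR. Qed.
Lemma ip0l x : ip 0 x = 0 :> R[i]%C.
Proof. exact: linear0l. Qed.
Lemma ip0r x : ip x 0 = 0 :> R[i]%C.
Proof. exact: linear0r. Qed.
Lemma ipC x y : ip x y = (ip y x)^*.
Proof. by rewrite (hermC (@ip R H)) expr0 mul1r. Qed.

Lemma ip_ge0 x : 0 <= ip x x.
Proof. by rewrite -ip_norm exprn_ge0. Qed.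

Lemma ip_eq0 x : ip x x = 0 -> x = 0.
Proof. by rewrite -ip_norm => /eqP; rewrite expf_eq0 /= normr_eq0 => /eqP. Qed.

Lemma ip_ext x y : (forall z, ip x z = ip y z) -> x = y.
Proof.
by move=> h; apply/eqP; rewrite -subr_eq0; apply/eqP/ip_eq0; rewrite ipBl h subrr.
Qed.

Lemma ip_linl a x y z : ip (a *: x + y) z = a * ip x z + ip y z.
Proof. by rewrite ipDl ipZl. Qed.

Lemma ip_CauchySchwarz x y : `|ip x y| <= `|x| * `|y|.
Proof.
rewrite -ler_sqr ?nnegrE ?mulr_ge0// exprMn !ip_norm.
rewrite (@ge0_complexE _ (`|_| ^+ 2)) ?exprn_ge0//.
rewrite (ge0_complexE (ip_ge0 x)) (ge0_complexE (ip_ge0 y)) -rmorphM lecR.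
exact: (semiip_CauchySchwarz ip_linl ipC ip_ge0).
Qed.

Section Sequences.
Local Notation C := R[i]%C.
Implicit Types (V W : normedModType C).

Lemma cvg_dominated V W (u : nat -> V) (v : nat -> W) l :
  (forall n, `|u n - l| <= `|v n|) -> v n @[n --> \oo] --> 0 ->
  u n @[n --> \oo] --> l.
Proof.
move=> h /cvgr0Pnorm_le v0; apply/cvgrPdist_le => e e0.
near=> n; rewrite distrC (le_trans (h n))//; near: n; exact: v0.
Unshelve. all: by end_near. Qed.

Lemma cauchy_cvg_seq (u : nat -> H) :
  (forall e : R, 0 < e -> exists N, forall n m, (N <= n)%N -> (N <= m)%N ->
     `|u n - u m| <= (e%:C)%C) ->
  exists l : H, u n @[n --> \oo] --> l.
Proof.
move=> h; suff c : cvgn u by exists (limn u).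
apply: cauchy_cvg; apply/cauchy_ballP => e e0.
have er := ge0_complexE (ltW e0).
have er0 : 0 < Re e by move: e0; rewrite ltcE => /andP[].
have e1 : 0 < Re e / 2 by rewrite divr_gt0.
have [N hN] := h _ e1.
exists (u @` [set n | (N <= n)%N], u @` [set n | (N <= n)%N]).
  by split; exists N => // n Nn; exists n.
move=> [_ _] /= [[n Nn <-] [m Nm <-]]; rewrite -ball_normE /=.
apply: le_lt_trans (hN _ _ Nn Nm) _.
by rewrite [ltRHS]er ltcR ltr_pdivrMr// ltr_pMr// ltrDl.
Qed.

Lemma cvg_cauchy_seq V (v : nat -> V) (l : V) : v n @[n --> \oo] --> l ->
  forall e : R, 0 < e -> exists N, forall n m, (N <= n)%N -> (N <= m)%N ->
     `|v n - v m| <= (e%:C)%C.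
Proof.
move=> /cvgrPdist_le h e e0.
have e1 : 0 < ((e / 2)%:C)%C by rewrite ltcR divr_gt0.
have [N _ hN] := h _ e1; exists N => n m Nn Nm.
have -> : v n - v m = (l - v m) - (l - v n) by rewrite opprB [RHS]addrC subrKA.
apply: (le_trans (ler_normB _ _)).
by rewrite [e]splitr rmorphD lerD//; apply: hN.
Qed.

Lemma cvg_of_dominated V (u : nat -> H) (v : nat -> V) (l : V) :
  (forall n m, `|u n - u m| <= `|v n - v m|) -> v n @[n --> \oo] --> l ->
  exists k : H, u n @[n --> \oo] --> k.
Proof.
move=> h /cvg_cauchy_seq c; apply: cauchy_cvg_seq => e e0.
by have [N hN] := c _ e0; exists N => n m Nn Nm; apply: le_trans (h _ _) (hN _ _ Nn Nm).
Qed.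

Lemma inv_nat_small (e : R) : 0 < e ->
  exists N, forall n, (N <= n)%N -> n.+1%:R^-1 <= e.
Proof.
move=> e0; exists (Num.truncn e^-1) => n Nn.
rewrite invf_ple ?posrE// (le_trans (ltW (truncnS_gt _)))//.
by rewrite ler_nat.
Qed.

(** Completeness turns the estimate of [approximate_riesz] into convergence. *)
Lemma cvg_minimizing (u : nat -> H) :
  (forall n m, Re (ip (u n - u m) (u n - u m)) <= 2 * (n.+1%:R^-1 + m.+1%:R^-1)) ->
  exists l : H, u n @[n --> \oo] --> l.
Proof.
move=> h; apply: cauchy_cvg_seq => e e0.
have e1 : 0 < e ^+ 2 / 4 by rewrite divr_gt0// exprn_gt0.
have [N hN] := inv_nat_small e1.
exists N => n m Nn Nm.
rewrite -ler_sqr ?nnegrE ?ler0c ?(ltW e0)// ip_norm (ge0_complexE (ip_ge0 _)).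
rewrite -rmorphXn lecR; apply: (le_trans (h n m)).
have := hN _ Nn; have := hN _ Nm.
by move: (n.+1%:R^-1) (m.+1%:R^-1) => a b; lra.
Qed.

Lemma cvg_ip (u v : nat -> H) x y :
  u n @[n --> \oo] --> x -> v n @[n --> \oo] --> y ->
  (ip (u n) (v n) : C^o) @[n --> \oo] --> (ip x y : C^o).
Proof.
move=> ux vy.
apply: (@cvg_dominated C^o C^o _
  (fun n => `|u n - x| * `|v n| + `|x| * `|v n - y|)).
  move=> n.
  have -> : ip (u n) (v n) - ip x y = ip (u n - x) (v n) + ip x (v n - y).
    by rewrite ipBl ipBr addrA subrK.
  rewrite [leRHS]ger0_norm ?addr_ge0 ?mulr_ge0//.
  by rewrite (le_trans (ler_normD _ _))// lerD// ip_CauchySchwarz.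
have -> : (0 : C^o) = `|0 : H| * `|y| + `|x| * `|0 : H|.
  by rewrite !normr0 mul0r mulr0 addr0.
have ux0 : u n - x @[n --> \oo] --> 0 by apply/subr_cvg0.
have vy0 : v n - y @[n --> \oo] --> 0 by apply/subr_cvg0.
apply: cvgD; apply: cvgM; try exact: cvg_cst; exact: cvg_norm.
Qed.

Lemma seq_lim_unique V (u : nat -> V) (x y : V) : u n @[n --> \oo] --> x ->
  u n @[n --> \oo] --> y -> x = y.
Proof. by move=> ux uy; apply: (cvg_unique _ ux uy). Qed.

Lemma cvg_inv_nat : (n.+1%:R^-1 : C^o) @[n --> \oo] --> (0 : C^o).
Proof.
apply/cvgr0Pnorm_le => e e0.
have er0 : 0 < Re e by move: e0; rewrite ltcE => /andP[].
have [N hN] := inv_nat_small er0.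
exists N => // n /= Nn; rewrite (ge0_complexE (ltW e0)) ger0_norm//.
have -> : n.+1%:R^-1 = ((n.+1%:R^-1 : R)%:C)%C by rewrite fmorphV rmorph_nat.
by rewrite lecR hN.
Qed.

Lemma seq_lim_norm_mono V W (u : nat -> V) (v : nat -> W) (x : V) (y : W) :
  u n @[n --> \oo] --> x -> v n @[n --> \oo] --> y ->
  (forall n, `|v n| <= `|u n|) -> `|y| <= `|x|.
Proof.
move=> /cvgrPdist_le ux /cvgrPdist_le vy vu.
rewrite real_leNgt ?normr_real//; apply/negP => lt.
have d0 : 0 < `|y| - `|x| by rewrite subr_gt0.
have e0 : 0 < (`|y| - `|x|) / 3 by rewrite divr_gt0.
have [N1 _ h1] := ux _ e0; have [N2 _ h2] := vy _ e0.
have {}h1 := h1 (maxn N1 N2) (leq_maxl _ _).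
have {}h2 := h2 (maxn N1 N2) (leq_maxr _ _).
move: h1 h2 (vu (maxn N1 N2)); move: (u _) (v _) => p q h1 h2 qp.
have hy : `|y| <= `|y - q| + `|q| by rewrite -{1}(subrK q y) ler_normD.
have hp : `|p| <= `|x - p| + `|x|.
  by rewrite -{1}(subKr x p) (le_trans (ler_normB _ _))// addrC.
have : `|y| - `|x| <= (`|y| - `|x|) / 3 + (`|y| - `|x|) / 3.
  rewrite lerBlDr (le_trans hy)// -addrA lerD// (le_trans qp)// (le_trans hp)// lerD//.
rewrite -subr_le0.
have -> : `|y| - `|x| - ((`|y| - `|x|) / 3 + (`|y| - `|x|) / 3) =
  (`|y| - `|x|) / 3 by field.
by move=> /(lt_le_trans e0); rewrite ltxx.
Qed.

Lemma seq_lim_norm_le V (u : nat -> V) (l : V) (c : C) : u n @[n --> \oo] --> l ->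
  (forall n, `|u n| <= c) -> `|l| <= c.
Proof.
move=> ul uc; have c0 : 0 <= c := le_trans (normr_ge0 _) (uc 0).
rewrite -[c in leRHS]ger0_norm//.
apply: (@seq_lim_norm_mono C^o V (fun=> c) u) (cvg_cst _) ul _ => n.
by rewrite ger0_norm.
Qed.

(** Operators are handled through sequences in their graphs; this lemma and
    the next translate from and to topological closedness. *)
Lemma closed_seq (T : set (H * H)) :
  (forall u v x y, (forall n : nat, T (u n, v n)) -> u n @[n --> \oo] --> x ->
    v n @[n --> \oo] --> y -> T (x, y)) -> closed T.
Proof.
move=> h [x y] cl.
have ex n : exists p : H * H,
    [/\ T p, `|x - p.1| <= n.+1%:R^-1 & `|y - p.2| <= n.+1%:R^-1].
  have e0 : 0 < n.+1%:R^-1 :> C by rewrite invr_gt0.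
  have [|[p q] [Tp []]] := cl (ball (x, y) (n.+1%:R^-1 : C)).
    exact: nbhsx_ballx.
  rewrite /= -!ball_normE /= => /ltW h1 /ltW h2; by exists (p, q).
have [w hw] := choice ex.
apply: (h (fun n => (w n).1) (fun n => (w n).2)).
- by move=> n; rewrite -surjective_pairing; case: (hw n).
- apply: (@cvg_dominated _ C^o _ (fun n => n.+1%:R^-1)).
    by move=> n; rewrite distrC [leRHS]ger0_norm; case: (hw n).
  exact: cvg_inv_nat.
- apply: (@cvg_dominated _ C^o _ (fun n => n.+1%:R^-1)).
    by move=> n; rewrite distrC [leRHS]ger0_norm; case: (hw n).
  exact: cvg_inv_nat.
Qed.

Lemma closed_seqP (T : set (H * H)) u v x y : closed T ->
  (forall n : nat, T (u n, v n)) -> u n @[n --> \oo] --> x ->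
    v n @[n --> \oo] --> y -> T (x, y).
Proof.
move=> cT h ux vy.
apply: (@closed_cvg _ _ \oo _ (fun n => (u n, v n)) T cT).
  by apply: nearW.
exact: cvg_pair.
Qed.

End Sequences.
End HilbertSpace.

(** * Riesz representation and density *)

Section Riesz.
Context {R : realType} {H : hilbertType R}.
Local Notation C := R[i]%C.
Implicit Types (x y z h : H) (a : C).

Lemma cvg_minimizing_value (b : nat -> C) (l : C) (K : R) :
  (forall n, Re (`|b n - l| ^+ 2) <= n.+1%:R^-1 * K) -> 0 <= K ->
  (b n : C^o) @[n --> \oo] --> (l : C^o).
Proof.
move=> h K0; apply/cvgrPdist_le => e e0.
have er0 : 0 < Re e by move: e0; rewrite ltcE => /andP[].
have K1 : 0 < K + 1 by lra.
have e1 : 0 < Re e ^+ 2 / (K + 1) by rewrite divr_gt0// exprn_gt0.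
have [N hN] := inv_nat_small e1.
exists N => // n /= /hN; rewrite ler_pdivlMr// => hn.
rewrite distrC (ge0_complexE (ltW e0)) -ler_sqr ?nnegrE ?normr_ge0 ?ler0c ?(ltW er0)//.
rewrite (@ge0_complexE _ (`|_| ^+ 2)) ?exprn_ge0// -(rmorphXn _ 2 (Re e)) lecR.
apply: (le_trans (h n)).
have : 0 <= n.+1%:R^-1 :> R by rewrite invr_ge0.
by move: (n.+1%:R^-1) hn => t; nra.
Qed.

Definition lin_subspace (E : lmodType C) (M : set E) :=
  M 0 /\ forall a u v, M u -> M v -> M (a *: u + v).

(** The inner product of the Hilbert sum: the norm that the product type
    carries is the supremum norm, which is not Hilbertian. *)
Definition pairip (p q : H * H) : C := ip p.1 q.1 + ip p.2 q.2.

Lemma pairip_linear a (u v w : H * H) :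
  pairip (a *: u + v) w = a * pairip u w + pairip v w.
Proof. by rewrite /pairip !ip_linl mulrDr addrACA. Qed.

Lemma pairipC (p q : H * H) : pairip p q = (pairip q p)^*.
Proof. by rewrite /pairip rmorphD /= -!ipC. Qed.

Lemma pairip_ge0 (p : H * H) : 0 <= pairip p p.
Proof. by rewrite addr_ge0// ip_ge0. Qed.

(** [(x, y)] is the orthogonal projection of [p] onto the closure of [M]. *)
Lemma riesz_graph (M : set (H * H)) (p : H * H) : lin_subspace M ->
  exists (u v : nat -> H) x y,
    [/\ forall n, M (u n, v n), u n @[n --> \oo] --> x, v n @[n --> \oo] --> y
      & forall s t, M (s, t) -> ip s x + ip t y = ip s p.1 + ip t p.2].
Proof.
move=> [M0 Mlin].
have fb q : M q -> Re (`|pairip q p| ^+ 2) <= Re (pairip p p) * Re (pairip q q).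
  by move=> _; rewrite mulrC (semiip_CauchySchwarz pairip_linear pairipC pairip_ge0).
have [w [Mw w_cauchy w_lim]] := approximate_riesz pairip_linear pairipC pairip_ge0
  M0 Mlin (fun a q r => pairip_linear a q r p) (Re_ge0 (pairip_ge0 p)) fb.
have [|x ux] := @cvg_minimizing R H (fun n => (w n).1).
  move=> n m; apply: le_trans (w_cauchy n m).
  by rewrite [in leRHS]raddfD /= lerDl Re_ge0// ip_ge0.
have [|y vy] := @cvg_minimizing R H (fun n => (w n).2).
  move=> n m; apply: le_trans (w_cauchy n m).
  by rewrite [in leRHS]raddfD /= lerDr Re_ge0// ip_ge0.
exists (fun n => (w n).1), (fun n => (w n).2), x, y; split=> //.
  by move=> n; rewrite -surjective_pairing.
move=> s t Mst.
apply: (@seq_lim_unique R C^o (fun n => pairip (s, t) (w n) : C^o)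
  (pairip (s, t) (x, y)) (pairip (s, t) p)).
  by apply: cvgD; apply: cvg_ip => //; apply: cvg_cst.
apply: cvg_minimizing_value (Re_ge0 (pairip_ge0 (s, t))) => n.
exact: w_lim.
Qed.

(** When [M] is the graph of a contraction [V], the vector [x] is the value at
    [h] of the adjoint of [V], and [y] is [V x] for the extension of [V] to the
    closure of its domain. *)
Lemma riesz_dominated (M : set (H * H)) h : lin_subspace M ->
  (forall s t, M (s, t) -> `|t| <= `|s|) ->
  exists (u v : nat -> H) x y,
    [/\ forall n, M (u n, v n), u n @[n --> \oo] --> x, v n @[n --> \oo] --> y
      & forall s t, M (s, t) -> ip s x = ip t h].
Proof.
move=> [M0 Mlin] Mle.
pose B (p q : H * H) : C := ip p.1 q.1.
have Blin a p q r : B (a *: p + q) r = a * B p r + B q r by exact: ip_linl.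
have BC p q : B p q = (B q p)^* by exact: ipC.
have B0 p : 0 <= B p p by exact: ip_ge0.
have fb p : M p -> Re (`|ip p.2 h| ^+ 2) <= Re (ip h h) * Re (B p p).
  case: p => s t /Mle ts.
  have cs := semiip_CauchySchwarz (@ip_linl R H) (@ipC R H) (@ip_ge0 R H).
  rewrite mulrC (le_trans (cs _ _))//.
  apply: ler_wpM2r; first by rewrite Re_ge0// ip_ge0.
  by rewrite -lecR -!(ge0_complexE (ip_ge0 _)) -!ip_norm ler_sqr ?nnegrE.
have [w [Mw w_cauchy w_lim]] := approximate_riesz Blin BC B0 M0 Mlin
  (fun a (p q : H * H) => ip_linl a p.2 q.2 h) (Re_ge0 (ip_ge0 h)) fb.
have [x ux] := @cvg_minimizing R H (fun n => (w n).1) w_cauchy.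
have [|y vy] := @cvg_of_dominated R H H (fun n => (w n).2) _ _ _ ux.
  move=> n m; apply: Mle.
  have := Mlin (-1) _ _ (Mw m) (Mw n).
  by rewrite scaleN1r addrC; case: (w n) (w m) => [? ?] [? ?].
exists (fun n => (w n).1), (fun n => (w n).2), x, y; split=> //.
  by move=> n; rewrite -surjective_pairing.
move=> s t Mst.
apply: (@seq_lim_unique R C^o (fun n => B (s, t) (w n) : C^o) (ip s x) (ip t h)).
  by apply: cvg_ip => //; apply: cvg_cst.
apply: cvg_minimizing_value (Re_ge0 (B0 (s, t))) => n.
exact: w_lim n (s, t) Mst.
Qed.

Lemma diag_lin_subspace (D : set H) : lin_subspace D ->
  lin_subspace [set p : H * H | D p.1 /\ p.2 = p.1].
Proof.
move=> [D0 Dl]; split=> // a [u1 u2] [v1 v2] [/= Du ->] [/= Dv ->].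
by split=> //; apply: Dl.
Qed.

(** Projecting [h] on the closure of [D], that is, applying
    [riesz_dominated] to the identity of [D], leaves a remainder orthogonal to
    [D]. *)
Lemma dense_of_orthogonal (D : set H) : lin_subspace D ->
  (forall h, (forall x, D x -> ip x h = 0) -> h = 0) -> dense D.
Proof.
move=> Dl Dorth O [h Oh] Oopen.
have [|u [v [x [y [Mu ux vy hx]]]]] := riesz_dominated h (diag_lin_subspace Dl).
  by move=> s t [/= _ ->].
have xh : x = h.
  apply/eqP; rewrite -subr_eq0; apply/eqP/Dorth => s Ds.
  by rewrite ipBr (hx s s)// subrr.
have [N _ hN] : \forall n \near \oo, O (u n).
  by apply: ux; rewrite xh; apply: open_nbhs_nbhs.
by exists (u N); split; [apply: hN => /= | case: (Mu N)].
Qed.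

Lemma dense_orthogonal (D : set H) h : dense D ->
  (forall x, D x -> ip x h = 0) -> h = 0.
Proof.
move=> Dd hD; apply: ip_eq0.
have ex n : exists x, D x /\ `|h - x| <= n.+1%:R^-1.
  have e0 : 0 < n.+1%:R^-1 :> C by rewrite invr_gt0.
  have [|x [hx Dx]] := Dd (ball h (n.+1%:R^-1 : C)) _ (ball_open _ _).
    by exists h; apply: ballxx.
  by exists x; split=> //; move: hx; rewrite -ball_normE /= => /ltW.
have [u hu] := choice ex.
have uh : u n @[n --> \oo] --> h.
  apply: (@cvg_dominated _ _ C^o _ (fun n => n.+1%:R^-1)).
    by move=> n; rewrite distrC [leRHS]ger0_norm; case: (hu n).
  exact: cvg_inv_nat.
apply: (@seq_lim_unique R C^o (fun n => ip (u n) h : C^o) (ip h h) 0).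
  by apply: cvg_ip => //; apply: cvg_cst.
rewrite (_ : (fun n => _) = (fun=> 0)); first exact: cvg_cst.
by apply/funext => n; apply: hD; case: (hu n).
Qed.

End Riesz.

(** * Square roots of nonnegative contractions *)

Section BoundedMaps.
Context {R : realType} {H : hilbertType R}.
Local Notation C := R[i]%C.
Implicit Types (x y z : H) (a : C) (f g : H -> H).

Lemma Re_le (p q : C) : p <= q -> Re p <= Re q.
Proof. by rewrite lecE => /andP[]. Qed.

(** A symmetric map defined on the whole space; linearity follows
    ([symmap_linear]). *)
Definition symmap f := forall x y, ip (f x) y = ip x (f y).

Definition nonnegmap f := forall x, 0 <= ip (f x) x.

Lemma symmap_linear f a x y : symmap f -> f (a *: x + y) = a *: f x + f y.
Proof. by move=> fs; apply: ip_ext => z; rewrite fs !ip_linl !fs. Qed.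

Lemma symmapB f : symmap f -> forall x y, f (x - y) = f x - f y.
Proof.
by move=> fs x y; rewrite addrC -scaleN1r symmap_linear// scaleN1r addrC.
Qed.

Lemma symmap0 f : symmap f -> f 0 = 0.
Proof. by move=> fs; rewrite -(subrr 0) (symmapB fs) !subrr. Qed.

(** Cauchy-Schwarz for the semi-inner product [<f x, y>] gives
    [|f x|^4 <= <f x, x> <f (f x), f x> <= |x|^2 |f x|^2]. *)
Lemma nonneg_form_contraction f : symmap f -> nonnegmap f ->
  (forall x, ip (f x) x <= ip x x) -> forall x, `|f x| <= `|x|.
Proof.
move=> fs f0 f1 x.
have Blin a u v w : ip (f (a *: u + v)) w = a * ip (f u) w + ip (f v) w.
  by rewrite symmap_linear// ip_linl.
have BC u v : ip (f u) v = (ip (f v) u)^* by rewrite fs ipC.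
have cs := semiip_CauchySchwarz Blin BC f0 x (f x).
suff : `|f x| ^+ 2 <= `|x| ^+ 2 by rewrite ler_sqr ?nnegrE.
rewrite !ip_norm.
move: (f1 x) (f1 (f x)) (f0 x) (f0 (f x)) (ip_ge0 (f x)) (ip_ge0 x).
rewrite (ge0_complexE (ip_ge0 (f x))) (ge0_complexE (ip_ge0 x)).
rewrite (ge0_complexE (f0 x)) (ge0_complexE (f0 (f x))).
rewrite !lecR; move: cs.
rewrite (ge0_complexE (ip_ge0 (f x))) -add_Re2_Im2 /= expr0n addr0.
move: (Re _) (Re _) (Re _) (Re _) => p q r s.
move=> h h1 h2 r0 s0 p0 q0.
have [//|lt] := leP p q; nra.
Qed.

Lemma contraction_form_le f x : (forall x, `|f x| <= `|x|) ->
  Re (ip (f x) x) <= Re (ip x x).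
Proof.
move=> fc; have h := Re_sqr_le_norm (ip (f x) x).
have c : Re (`|ip (f x) x| ^+ 2) <= Re (ip x x) ^+ 2.
  have -> : Re (ip x x) ^+ 2 = Re (ip x x ^+ 2).
    by rewrite {2}(ge0_complexE (ip_ge0 x)) -rmorphXn.
  apply: Re_le; rewrite -ip_norm -exprM exprM ler_sqr ?nnegrE ?exprn_ge0// expr2.
  by rewrite (le_trans (ip_CauchySchwarz _ _))// ler_wpM2r.
have := le_trans h c; have := Re_ge0 (ip_ge0 x).
by move: (Re _) (Re _) => p q p0 hh; nra.
Qed.

Section SquareRoot.
Variable b : H -> H.
Hypothesis bs : symmap b.
Hypothesis bc : forall x, `|b x| <= `|x|.

(** Iteration for the smaller root of [2 w = b + w^2]; then [1 - w] is a square
    root of [1 - b]. *)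
Fixpoint sqrt_iter n x : H :=
  if n is n'.+1 then 2^-1 *: (b x + sqrt_iter n' (sqrt_iter n' x)) else 0.

(** The same iteration for the number [b = 1], which dominates the iteration
    for contractions. *)
Fixpoint sqrt_bound n : R :=
  if n is n'.+1 then (1 + sqrt_bound n' ^+ 2) / 2 else 0.

Local Notation Y := sqrt_iter.
Local Notation y_ := sqrt_bound.

Let half_conj : (2^-1 : C)^* = 2^-1.
Proof. by rewrite fmorphV rmorph_nat. Qed.

Lemma sqrt_iter_sym n : symmap (Y n).
Proof.
elim: n => [|n IH] x z /=; first by rewrite ip0l ip0r.
by rewrite ipZl ipZr ipDl ipDr bs !IH half_conj.
Qed.

Lemma sqrt_iter_comm f n : symmap f -> (forall x, f (b x) = b (f x)) ->
  forall x, f (Y n x) = Y n (f x).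
Proof.
move=> fs fb; elim: n => [|n IH] x /=; first exact: symmap0.
have fD u v : f (u + v) = f u + f v.
  by have := symmap_linear 1 u v fs; rewrite !scale1r.
have fZ a u : f (a *: u) = a *: f u.
  by have := symmap_linear a u 0 fs; rewrite (symmap0 fs) !addr0.
by rewrite fZ fD fb !IH.
Qed.

Lemma sqrt_iter_b n x : b (Y n x) = Y n (b x).
Proof. by apply: sqrt_iter_comm. Qed.

Lemma sqrt_iterC n m x : Y n (Y m x) = Y m (Y n x).
Proof.
apply: sqrt_iter_comm; first exact: sqrt_iter_sym.
by move=> {}x; rewrite sqrt_iter_b.
Qed.

Lemma sqrt_bound_ge0 n : 0 <= y_ n.
Proof. by elim: n => //= n IH; rewrite divr_ge0// addr_ge0// exprn_ge0. Qed.

Lemma sqrt_bound_le1 n : y_ n <= 1.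
Proof. by elim: n => //= n IH; have := sqrt_bound_ge0 n; nra. Qed.

Lemma sqrt_bound_nd n : y_ n <= y_ n.+1.
Proof. by rewrite /=; have := sqr_ge0 (1 - y_ n); nra. Qed.

Lemma norm_half : `|2^-1 : C| = ((2^-1 : R)%:C)%C.
Proof. by rewrite ger0_norm// fmorphV rmorph_nat. Qed.

Lemma sqrt_iter_le n x : `|Y n x| <= ((y_ n)%:C)%C * `|x|.
Proof.
elim: n x => [|n IH] x /=; first by rewrite normr0 mul0r.
rewrite normrZ norm_half mulrC [X in X%:C%C * _]mulrC rmorphM mulrC -mulrA.
apply: ler_wpM2l; first by rewrite ler0c.
apply: (le_trans (ler_normD _ _)); rewrite rmorphD rmorph1 mulrDl mul1r lerD//.
rewrite rmorphXn expr2 -mulrA (le_trans (IH _))// ler_wpM2l// ler0c.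
exact: sqrt_bound_ge0.
Qed.

(** The iterates commute, so
    [Y_(n+2) - Y_(n+1) = (Y_(n+1) + Y_n) (Y_(n+1) - Y_n) / 2], and the same
    factorization holds for the dominating numbers. *)
Lemma sqrt_iter_step n x :
  `|Y n.+1 x - Y n x| <= ((y_ n.+1 - y_ n)%:C)%C * `|x|.
Proof.
elim: n x => [|n IH] x.
  rewrite /= expr0n/= !addr0 subr0 normrZ norm_half mul1r subr0.
  by apply: ler_wpM2l; rewrite ?ler0c.
have -> : Y n.+2 x - Y n.+1 x =
    2^-1 *: (Y n.+1 (Y n.+1 x - Y n x) + Y n (Y n.+1 x - Y n x)).
  rewrite -[Y n.+2 x]/(2^-1 *: (b x + Y n.+1 (Y n.+1 x))).
  rewrite -[Y n.+1 x in X in _ - X]/(2^-1 *: (b x + Y n (Y n x))).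
  rewrite -scalerBr !(symmapB (sqrt_iter_sym _)).
  by rewrite [Y n.+1 (Y n x)]sqrt_iterC subrKA opprD addrACA subrr add0r.
have -> : y_ n.+2 - y_ n.+1 = 2^-1 * ((y_ n.+1 + y_ n) * (y_ n.+1 - y_ n)).
  rewrite -[y_ n.+2]/((1 + y_ n.+1 ^+ 2) / 2).
  have e : y_ n.+1 = (1 + y_ n ^+ 2) / 2 by [].
  by rewrite [X in _ - X = _]e; move: (y_ n.+1) (y_ n) => p q; field.
rewrite normrZ norm_half rmorphM -mulrA ler_wpM2l ?ler0c//.
rewrite rmorphM -mulrA rmorphD mulrDl.
apply: (le_trans (ler_normD _ _)); apply: lerD.
  apply: (le_trans (sqrt_iter_le _ _)); apply: ler_wpM2l; last exact: IH.
  by rewrite ler0c sqrt_bound_ge0.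
apply: (le_trans (sqrt_iter_le _ _)); apply: ler_wpM2l; last exact: IH.
by rewrite ler0c sqrt_bound_ge0.
Qed.

Lemma sqrt_iter_dist n k x :
  `|Y (k + n) x - Y n x| <= ((y_ (k + n) - y_ n)%:C)%C * `|x|.
Proof.
elim: k => [|k IH]; first by rewrite add0n !subrr normr0 mul0r.
rewrite addSn -(subrKA (Y (k + n) x)) -(subrKA (y_ (k + n)) (y_ _)).
rewrite rmorphD mulrDl (le_trans (ler_normD _ _))// lerD//.
exact: sqrt_iter_step.
Qed.

(** The dominating numbers increase and are bounded by 1, so they form a Cauchy
    sequence, and the iterates do too. *)
Lemma sqrt_iter_cvg x : exists l : H, Y n x @[n --> \oo] --> l.
Proof.
have yc : cvgn y_.
  apply: nondecreasing_is_cvgn.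
    exact/nondecreasing_seqP/sqrt_bound_nd.
  by exists 1 => _ [n _ <-]; apply: sqrt_bound_le1.
apply: cauchy_cvg_seq => e e0.
have e1 : 0 < e / (Re `|x| + 1).
  by rewrite divr_gt0// ltr_wpDl// Re_ge0.
have [N _ hN] : \forall n \near \oo, `|limn y_ - y_ n| <= e / (Re `|x| + 1) / 2.
  by move/cvgrPdist_le : yc; apply; rewrite divr_gt0.
have main k n : (N <= n)%N -> `|Y (k + n) x - Y n x| <= (e%:C)%C.
  move=> Nn; apply: (le_trans (sqrt_iter_dist _ _ _)).
  rewrite (@ge0_complexE _ `|x|)// -rmorphM lecR.
  have x0 : 0 <= Re `|x| by rewrite Re_ge0.
  have : y_ (k + n) - y_ n <= e / (Re `|x| + 1).
    have := hN n Nn; have := hN (k + n)%N (leq_trans Nn (leq_addl _ _)).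
    rewrite !ler_norml => /andP[] ? ? /andP[] ? ?; lra.
  have yk : 0 <= y_ (k + n) - y_ n.
    rewrite subr_ge0; elim: k => [|k IH]; first by rewrite add0n.
    by rewrite addSn (le_trans IH)// sqrt_bound_nd.
  rewrite ler_pdivlMr ?ltr_wpDl//; nra.
exists N => n m Nn Nm; have [nm|/ltnW mn] := leqP n m.
  by rewrite distrC -(subnK nm); apply: main.
by rewrite -(subnK mn); apply: main.
Qed.

Lemma contraction_fixpoint : exists w : H -> H,
  [/\ symmap w, forall x, `|w x| <= `|x|,
      forall x, w x + w x = b x + w (w x)
    & forall f, symmap f -> (forall x, f (b x) = b (f x)) ->
        forall x, f (w x) = w (f x)].
Proof.
have [w hw] := choice sqrt_iter_cvg.
have ws : symmap w.
  move=> x z; apply: (@seq_lim_unique R C^o (fun n => ip (Y n x) z : C^o)).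
    by apply: cvg_ip (hw x) _; apply: cvg_cst.
  under eq_fun do rewrite sqrt_iter_sym.
  by apply: cvg_ip (hw z); apply: cvg_cst.
exists w; split=> //.
- move=> x; apply: seq_lim_norm_le (hw x) _ => n.
  rewrite (le_trans (sqrt_iter_le _ _))//.
  by rewrite ler_piMl// lecR sqrt_bound_le1.
- move=> x; apply: ip_ext => z.
  rewrite !ipDl [ip (w (w x)) z]ws.
  have hw1 : Y n.+1 x @[n --> \oo] --> w x.
    by move: (hw x); rewrite -cvg_shiftS.
  apply: (@seq_lim_unique R C^o (fun n => ip (Y n.+1 x) z + ip (Y n.+1 x) z : C^o)).
    by apply: cvgD; apply: cvg_ip hw1 _; exact: cvg_cst.
  have e n : ip (Y n.+1 x) z + ip (Y n.+1 x) z = ip (b x) z + ip (Y n x) (Y n z).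
    rewrite /= !ipZl -mulrDl -sqrt_iter_sym -ipDl.
    have -> : 2^-1 + 2^-1 = 1 :> C by field.
    by rewrite mul1r.
  under eq_fun do rewrite e.
  by apply: cvgD; [exact: cvg_cst|exact: cvg_ip].
- move=> f fs fb x; apply: ip_ext => z.
  apply: (@seq_lim_unique R C^o (fun n => ip (Y n (f x)) z : C^o)); last first.
    by apply: cvg_ip (hw _) _; apply: cvg_cst.
  under eq_fun do rewrite -(sqrt_iter_comm _ fs fb) fs.
  by rewrite fs; apply: cvg_ip (hw _) _; apply: cvg_cst.
Qed.

End SquareRoot.

(** The last clause, commutation with all symmetric maps commuting with [f],
    makes roots of commuting maps commute. *)
Lemma bounded_sqrt_exists f : symmap f -> nonnegmap f ->
  (forall x, ip (f x) x <= ip x x) ->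
  exists r : H -> H,
  [/\ symmap r, nonnegmap r, forall x, `|r x| <= `|x|,
      forall x, r (r x) = f x
    & forall g, symmap g -> (forall x, g (f x) = f (g x)) ->
        forall x, g (r x) = r (g x)].
Proof.
move=> fs f0 f1; pose b x := x - f x.
have bs : symmap b by move=> x z; rewrite ipBl ipBr fs.
have bc : forall x, `|b x| <= `|x|.
  apply: nonneg_form_contraction => // x; rewrite /b ipBl ?subr_ge0//.
  by rewrite gerBl.
have [w [ws wc ww wcomm]] := contraction_fixpoint bs bc.
exists (fun x => x - w x).
have rs : symmap (fun x => x - w x) by move=> x z; rewrite ipBl ipBr ws.
have r2 x : (x - w x) - w (x - w x) = f x.
  (* This is (1 - w)^2 = 1 - 2 w + w^2 = 1 - b. *)
  have -> : (x - w x) - w (x - w x) = x - (w x + w x) + w (w x).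
    by rewrite (symmapB ws) opprB opprD !addrA [RHS]addrAC.
  by rewrite ww opprD addrA subrK /b subKr.
have r0 : nonnegmap (fun x => x - w x).
  move=> x; have : ip (x - w x) x = (ip (x - w x) x)^* by rewrite -ipC rs.
  move=> e; rewrite lecE; apply/andP; split; last first.
    by rewrite ipBl raddfB /= subr_ge0; apply: contraction_form_le.
  move: e; case: (ip _ _) => p q /= [/eqP]; rewrite -addr_eq0 -mulr2n mulrn_eq0 /=.
  by move=> /eqP ->.
split=> //.
- move=> x; rewrite -ler_sqr ?nnegrE// !ip_norm -rs r2; exact: f1.
- move=> g gs gf x; rewrite (symmapB gs) (wcomm g)// => z.
  by rewrite /b (symmapB gs) gf.
Qed.
End BoundedMaps.

(** * The operator adj T T and its square root *)

Section UnboundedOperators.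
Context {R : realType} {H : hilbertType R}.
Local Notation C := R[i]%C.
Implicit Types (x y z u v h : H) (a : C) (f g : H -> H) (T A S : set (H * H)).

Lemma linop_subspace T : linop T -> lin_subspace T.
Proof.
move=> [T0 Tl _]; split; first exact: T0.
by move=> a [x y] [u v]; apply: Tl.
Qed.

Lemma linop_fun T x y y' : linop T -> T (x, y) -> T (x, y') -> y = y'.
Proof. by move=> [_ _]; apply. Qed.

Lemma linopB T x y u v : linop T -> T (x, y) -> T (u, v) -> T (x - u, y - v).
Proof.
move=> [_ Tl _] Tx Tu; rewrite addrC -scaleN1r [y - v]addrC -[- v]scaleN1r.
exact: Tl.
Qed.

Lemma dom_subspace T : linop T -> lin_subspace (dom T).
Proof.
move=> [T0 Tl _]; split; first by exists 0.
by move=> a x u [y Ty] [v Tv]; exists (a *: y + v); apply: Tl.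
Qed.

Lemma adj_ip T x y u v : adj T (u, v) -> T (x, y) -> ip u y = ip v x.
Proof. by move=> aT Txy; rewrite ipC (aT _ _ Txy) -ipC. Qed.

Lemma adj_closed T : closed (adj T).
Proof.
apply: closed_seq => u v x y aT ux vy s t Tst /=.
apply: (@seq_lim_unique R C^o (fun n => ip t (u n) : C^o)).
  by apply: cvg_ip => //; apply: cvg_cst.
under eq_fun do rewrite (aT _ _ _ Tst) /=.
by apply: cvg_ip => //; apply: cvg_cst.
Qed.

Lemma selfadjoint_closed A : selfadjoint A -> closed A.
Proof. by move=> [_ _ <-]; apply: adj_closed. Qed.

Lemma selfadjoint_sym A x y u v : selfadjoint A -> A (x, y) -> A (u, v) ->
  ip y u = ip x v.
Proof. by move=> [_ _ aA] Ax; rewrite -{1}aA => Au; apply: Au. Qed.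

Lemma opmulA A T S : opmul A (opmul T S) = opmul (opmul A T) S.
Proof.
apply/seteqP; split=> -[x y] /=.
  by move=> [z [w Sw Tz] Az]; exists w => //; exists z.
by move=> [w Sw [z Tz Az]]; exists z => //; exists w.
Qed.

Section AdjointProduct.
Variable T : set (H * H).
Hypotheses (linT : linop T) (closedT : closed T) (denseT : dense (dom T)).
Local Notation N := (opmul (adj T) T).

(** Surjectivity of [1 + adj T T]: the projection of [(h, 0)] onto the graph of
    [T] is [(x, T x)] with [<u, h - x> = <T u, T x>] for all [u] in [dom T]. *)
Lemma adjmul_onto h : exists x, N (x, h - x).
Proof.
have [u [v [x [y [Tuv ux vy orth]]]]] := riesz_graph (h, 0) (linop_subspace linT).
exists x; exists y; first exact: (closed_seqP closedT Tuv ux vy).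
move=> s t /orth /=; rewrite ip0r addr0 ipBr => <-.
by rewrite addrAC subrr add0r.
Qed.

Lemma adjmul_sym x y u v : N (x, y) -> N (u, v) -> ip y u = ip x v.
Proof. by move=> [c Tc ac] [d Td ad]; rewrite -(adj_ip ac Td) (ad _ _ Tc). Qed.

Lemma adj_fun c y y' : adj T (c, y) -> adj T (c, y') -> y = y'.
Proof.
move=> ay ay'; apply/eqP; rewrite -subr_eq0; apply/eqP.
apply: (dense_orthogonal denseT) => x [t Tt].
by rewrite ipBr -(ay _ _ Tt) -(ay' _ _ Tt) subrr.
Qed.

Lemma adjmul_linop : linop N.
Proof.
have [T0 Tl Tf] := linT; split.
- by exists 0 => // x y _ /=; rewrite !ip0r.
- move=> a x y x' y' [c Tc ac] [c' Tc' ac']; exists (a *: c + c') => /=.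
    exact: Tl.
  by move=> s t Tst /=; rewrite !ipDr !ipZr (ac _ _ Tst) (ac' _ _ Tst).
- move=> x y y' [c Tc ac] [c' Tc' ac'].
  by apply: (adj_fun ac); rewrite /= (Tf _ _ _ Tc Tc').
Qed.

Lemma adjmul_nonneg : nonneg N.
Proof. by move=> x y [c Tc ac]; rewrite -(adj_ip ac Tc) ip_ge0. Qed.

(** Theorem of von Neumann. A symmetric operator [N] with [1 + N] onto is
    selfadjoint: if [v = adj N u], solve [(1 + N) w = u + v]; then [u - w] is
    orthogonal to the range of [1 + N]. *)
Lemma adjmul_selfadjoint : nonneg_selfadjoint N.
Proof.
split; last exact: adjmul_nonneg.
split; first exact: adjmul_linop.
  apply: dense_of_orthogonal; first exact: dom_subspace adjmul_linop.
  move=> h orth; have [x Nx] := adjmul_onto h.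
  (* From (1 + N) x = h follows 0 <= <N x, x> = - |x|^2. *)
  have x0 : x = 0.
    apply: ip_eq0; apply/eqP; rewrite eq_le ip_ge0 andbT.
    have := adjmul_nonneg Nx; rewrite ipBl [ip h x]ipC orth; last by exists (h - x).
    by rewrite conjC0 sub0r oppr_ge0.
  move: Nx; rewrite x0 subr0 => N0.
  by apply: (linop_fun adjmul_linop N0); case: adjmul_linop.
apply/seteqP; split=> -[u v] aN; last first.
  by move=> x y Nxy; apply: adjmul_sym Nxy aN.
have [w Nw] := adjmul_onto (u + v).
suff uw : u = w by move: Nw; rewrite -uw addrAC subrr add0r.
apply: ip_ext => z; have [x Nx] := adjmul_onto z.
rewrite ipC [RHS]ipC; congr (_^*).
have : ip (z - x) u + ip x u = ip (z - x) w + ip x w.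
  by rewrite (aN _ _ Nx) (adjmul_sym Nx Nw) /= -!ipDr [v + u]addrC subrK.
by rewrite !ipBl !subrK.
Qed.

(** The map [g] is the inverse of [1 + adj T T]. *)
Lemma adjmul_resolvent : exists g : H -> H,
  [/\ symmap g, nonnegmap g, forall x, ip (g x) x <= ip x x &
      forall x y, N (x, y) <-> g (x + y) = x].
Proof.
have [g hg] := choice adjmul_onto; exists g.
have gle x : 0 <= ip (g x) (x - g x).
  by rewrite -(adjmul_sym (hg x) (hg x)); apply: adjmul_nonneg (hg x).
split.
- move=> x z; have := adjmul_sym (hg x) (hg z).
  by rewrite ipBl ipBr => /(congr1 (+%R^~ (ip (g x) (g z)))); rewrite !subrK.
- by move=> x; have := addr_ge0 (gle x) (ip_ge0 (g x)); rewrite -ipDr subrK.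
- move=> x; rewrite -subr_ge0 -ipBl -[x in ip _ x](subrK (g x)) ipDr.
  rewrite addr_ge0 ?ip_ge0//.
  by rewrite (adjmul_sym (hg x) (hg x)) gle.
- move=> x y; split=> [Nxy|e].
    have := hg (x + y); set w := g _ => Nw.
    have := linopB adjmul_linop Nxy Nw.
    have -> : y - (x + y - w) = - (x - w).
      by rewrite !opprB [x + y]addrC opprD addrCA addNKr.
    move=> /adjmul_nonneg; rewrite -scaleN1r ipZl mulN1r oppr_ge0 => le0.
    apply/esym/eqP; rewrite -subr_eq0; apply/eqP/ip_eq0/eqP.
    by rewrite eq_le le0 ip_ge0.
  by have := hg (x + y); rewrite e addrAC subrr add0r.
Qed.

(** The domain of [adj T T] is a core of [T]. Project [(x, T x)] onto the closure
    of the graph of [T] restricted to that domain; the first component of the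
    remainder is orthogonal to the range of [1 + adj T T], so it vanishes. *)
Lemma adjmul_core x y : T (x, y) -> exists u v w : nat -> H,
  [/\ forall n, T (u n, v n), forall n, adj T (v n, w n),
      u n @[n --> \oo] --> x & v n @[n --> \oo] --> y].
Proof.
move=> Txy; pose M := [set p | T p /\ exists z, adj T (p.2, z)].
have Ml : lin_subspace M.
  have [T0 Tl _] := linT; split.
    by split; [exact: T0 | exists 0 => s t _ /=; rewrite !ip0r].
  move=> a [x1 y1] [x2 y2] [/= T1 [z1 a1]] [/= T2 [z2 a2]]; split; first exact: Tl.
  exists (a *: z1 + z2) => s t Tst /=.
  by rewrite !ipDr !ipZr (a1 _ _ Tst) (a2 _ _ Tst).
have [u [v [x' [y' [Muv ux vy orth]]]]] := riesz_graph (x, y) Ml.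
have Txy' : T (x', y').
  by apply: closed_seqP closedT _ ux vy => n; case: (Muv n).
have xx' : x' = x.
  apply: ip_ext => h; have [z [c Tc /= ac]] := adjmul_onto h.
  rewrite ipC [RHS]ipC; congr (_^*).
  have : M (z, c) by split=> //; exists (h - z).
  move=> /orth /=.
  rewrite (adj_ip ac Txy) (adj_ip ac Txy') -!ipDl.
  by rewrite addrC subrK.
have yy' : y' = y by apply: (linop_fun linT Txy'); rewrite xx'.
have [w hw] := choice (fun n => (Muv n).2).
by exists u, v, w; split=> //; [move=> n; case: (Muv n) | rewrite -xx' | rewrite -yy'].
Qed.

End AdjointProduct.

Lemma adjB T x y u v : adj T (x, y) -> adj T (u, v) -> adj T (x - u, y - v).
Proof. by move=> ax au s t Tst /=; rewrite !ipBr (ax _ _ Tst) (au _ _ Tst). Qed.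

Lemma adj_norm_eq (T1 T2 : set (H * H)) x c1 c2 y :
  T1 (x, c1) -> adj T1 (c1, y) -> T2 (x, c2) -> adj T2 (c2, y) -> `|c1| = `|c2|.
Proof.
move=> T1x a1 T2x a2; apply/eqP; rewrite -(@eqrXn2 _ 2)// !ip_norm.
by rewrite (adj_ip a1 T1x) (adj_ip a2 T2x).
Qed.

(** On the domain of the common operator [adj T1 T1 = adj T2 T2] the norms of
    [T1 x] and [T2 x] are determined by its quadratic form; this passes to
    [dom T1] because that domain is a core of [T1]. *)
Lemma adjmul_eq_form_sub (T1 T2 : set (H * H)) :
  linop T1 -> closed T1 -> linop T2 -> closed T2 ->
  opmul (adj T1) T1 = opmul (adj T2) T2 ->
  forall x y, T1 (x, y) -> exists2 y', T2 (x, y') & `|y'| = `|y|.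
Proof.
move=> l1 c1 l2 c2 e x y Txy.
have [u [v [w [Tuv avw ux vy]]]] := adjmul_core l1 c1 Txy.
have ex n : exists v', T2 (u n, v') /\ adj T2 (v', w n).
  have : opmul (adj T1) T1 (u n, w n) by exists (v n); [apply: Tuv | apply: avw].
  by rewrite e => -[v' ? ?]; exists v'.
have [v' hv'] := choice ex.
have nrm n m : `|v' n - v' m| = `|v n - v m|.
  have [T2n a2n] := hv' n; have [T2m a2m] := hv' m.
  exact: adj_norm_eq (linopB l2 T2n T2m) (adjB a2n a2m)
    (linopB l1 (Tuv n) (Tuv m)) (adjB (avw n) (avw m)).
have [y' vy'] : exists y' : H, v' n @[n --> \oo] --> y'.
  by apply: cvg_of_dominated vy => n m; rewrite nrm.
exists y'; first by apply: closed_seqP c2 _ ux vy' => n; case: (hv' n).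
apply: (@seq_lim_unique R C^o (fun n => `|v' n| : C^o)); first exact: cvg_norm.
have -> : (fun n => `|v' n| : C^o) = (fun n => `|v n|).
  apply/funext => n; have [T2n a2n] := hv' n.
  exact: adj_norm_eq T2n a2n (Tuv n) (avw n).
exact: cvg_norm.
Qed.

(** With [g = (1 + adj T T)^-1] one has [adj T T = g^-1 - 1], so for commuting
    roots [p] of [g] and [q] of [1 - g] the square root is [q p^-1]. Its graph is
    the set of pairs [(p z, q z)], and [p^2 + q^2 = 1] replaces all domain
    considerations. *)
Lemma sqrt_exists T : linop T -> closed T -> dense (dom T) ->
  exists S, nonneg_selfadjoint S /\ opmul S S = opmul (adj T) T.
Proof.
move=> lT cT dT; have [g [gs g0 g1 gN]] := adjmul_resolvent lT cT dT.
have [p [ps p0 pc pp pcomm]] := bounded_sqrt_exists gs g0 g1.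
pose k x := x - g x.
have ks : symmap k by move=> x z; rewrite ipBl ipBr gs.
have k0 : nonnegmap k by move=> x; rewrite ipBl subr_ge0.
have k1 x : ip (k x) x <= ip x x by rewrite ipBl gerBl.
have [q [qs q0 qc qq qcomm]] := bounded_sqrt_exists ks k0 k1.
have pg x : p (g x) = g (p x) by rewrite -!pp.
have pq x : p (q x) = q (p x).
  by apply: (qcomm p ps) => z; rewrite /k (symmapB ps) pg.
have p1 x : ip (p x) x <= ip x x.
  by rewrite (ge0_complexE (p0 x)) (ge0_complexE (ip_ge0 x)) lecR contraction_form_le.
have [r [rs r0 rc rr rcomm]] := bounded_sqrt_exists ps p0 p1.
have rq x : r (q x) = q (r x) by rewrite (rcomm q qs)// => z; rewrite pq.
have pq1 x : p (p x) + q (q x) = x by rewrite pp qq /k addrC subrK.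
have pinj x : p x = 0 -> x = 0.
  move=> px; have gx : g x = 0 by rewrite -pp px (symmap0 ps).
  (* [g] is injective, as an inverse. *)
  have N0 : opmul (adj T) T (0, x) by apply/gN; rewrite add0r.
  apply: (linop_fun (adjmul_linop lT dT) N0).
  by case: (adjmul_linop lT dT).
have pD x y : p (x + y) = p x + p y.
  by have := symmap_linear 1 x y ps; rewrite !scale1r.
pose S : set (H * H) := [set v | exists z, v = (p z, q z)].
have Slin : linop S.
  split.
  - by exists 0; rewrite (symmap0 ps) (symmap0 qs).
  - move=> a x y x' y' [z [-> ->]] [z' [-> ->]]; exists (a *: z + z').
    by rewrite (symmap_linear _ _ _ ps) (symmap_linear _ _ _ qs).
  - move=> x y y' [z [-> ->]] [z' [e ->]]; congr q.
    by apply/eqP; rewrite -subr_eq0; apply/eqP/pinj; rewrite (symmapB ps) e subrr.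
have Ssa : nonneg_selfadjoint S.
  split; last first.
    move=> x y [z [-> ->]].
    (* <q z, p z> = <q (r z), r z>, where [r] is the root of [p]. *)
    by rewrite -(rr z) -rs rq; apply: q0.
  split=> //.
    apply: dense_of_orthogonal; first exact: dom_subspace.
    move=> h orth; apply: pinj; apply: ip_eq0; rewrite ps ipC orth ?conjC0//.
    by exists (q (p h)), (p h).
  apply/seteqP; split=> -[u v] aS; last first.
    move=> x y [z [-> ->]]; case: aS => w [-> ->] /=.
    by rewrite qs ps pq.
  have e : q u = p v.
    apply: ip_ext => z; rewrite qs ps ipC [RHS]ipC; congr (_^*).
    by apply: aS; exists z.
  exists (p u + q v).
  have qD x y : q (x + y) = q x + q y.
    by have := symmap_linear 1 x y qs; rewrite !scale1r.
  by rewrite pD qD pq -e pq1 -pq e pq1.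
exists S; split=> //.
apply/seteqP; split=> -[x y].
  move=> [w [z [/= -> ->]] [z' [/= e ->]]].
  by apply/gN; rewrite -pp pD pq -e pq1.
move=> /gN e.
exists (q (p (x + y))).
  by exists (p (x + y)); rewrite pp e.
exists (q (x + y)); congr pair; first by rewrite pq.
by rewrite qq /k e addrAC subrr add0r.
Qed.

End UnboundedOperators.

(** * Factorizations T = A B *)

Section Factorization.
Context {R : realType} {H : hilbertType R}.
Local Notation C := R[i]%C.
Implicit Types (x y z u v h : H) (a : C) (f g : H -> H) (T A B S : set (H * H)).

Lemma opsqrtP A : (exists S, nonneg_selfadjoint S /\ opmul S S = A) ->
  nonneg_selfadjoint (opsqrt A) /\ opmul (opsqrt A) (opsqrt A) = A.
Proof.
move=> [S hS].
pose P : set (set (H * H)) := [set S | nonneg_selfadjoint S /\ opmul S S = A].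
exact: (@xgetPex _ set0 P) (ex_intro _ S hS).
Qed.

(** The default value of [opsqrt] has empty domain, so one point in the domain
    already certifies that a square root exists. *)
Lemma opsqrt_dom_nonempty A x : dom (opsqrt A) x ->
  nonneg_selfadjoint (opsqrt A) /\ opmul (opsqrt A) (opsqrt A) = A.
Proof.
move=> [y]; rewrite /opsqrt; by case: xgetP => [S _ hS _|_ []//].
Qed.

Lemma selfadjoint_sqr S : selfadjoint S -> opmul (adj S) S = opmul S S.
Proof. by case=> _ _ ->. Qed.

(** The square root [S] of [adj T T] satisfies [adj S S = S S = adj T T], so [S] and
    [T] have the same domain and the same norms. *)
Lemma opsqrt_polar T : linop T -> closed T -> dense (dom T) ->
  (forall x y, T (x, y) -> exists2 s, opsqrt (opmul (adj T) T) (x, s) & `|s| = `|y|) /\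
  (forall x s, opsqrt (opmul (adj T) T) (x, s) -> exists2 y, T (x, y) & `|y| = `|s|).
Proof.
move=> lT cT dT; have [[Ssa _] Ssq] := opsqrtP (sqrt_exists lT cT dT).
have [lS dS aS] := Ssa; have cS := selfadjoint_closed Ssa.
split; apply: adjmul_eq_form_sub => //; by rewrite (selfadjoint_sqr Ssa) Ssq.
Qed.

Lemma opsqrt_polar_norm T x y s : linop T -> closed T -> dense (dom T) ->
  T (x, y) -> opsqrt (opmul (adj T) T) (x, s) -> `|s| = `|y|.
Proof.
move=> lT cT dT Txy /(opsqrt_polar lT cT dT).2 [y' Txy' <-].
by rewrite (linop_fun lT Txy Txy').
Qed.

Definition graph f : set (H * H) := [set p | p.2 = f p.1].

Lemma graphP f x y : graph f (x, y) <-> y = f x.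
Proof. by []. Qed.

Lemma graph_Bplus f : symmap f -> nonnegmap f -> (forall x, `|f x| <= `|x|) ->
  Bplus (graph f).
Proof.
move=> fs f0 fc.
have domT : dom (graph f) = setT by apply/seteqP; split=> // x _; exists (f x).
split=> //; last first.
  by exists 1 => x y /graphP ->; rewrite mul1r.
split; last by move=> x y /graphP ->.
split.
- split; first by rewrite /graph /= (symmap0 fs).
    move=> a x y x' y' /graphP -> /graphP ->; apply/graphP.
    by rewrite (symmap_linear _ _ _ fs).
  by move=> x y y' /graphP -> /graphP ->.
- by rewrite domT => O [x Ox] _; exists x.
apply/seteqP; split=> -[u v] /=.
  move=> h; apply: ip_ext => z; rewrite fs ipC [RHS]ipC; congr (_^*).
  by rewrite -[LHS](h z (f z)).
by move=> /graphP -> x y /graphP ->; rewrite fs.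
Qed.

(** The bound is kept positive, so that it can serve as a scaling factor. *)
Lemma Bplus_graph A : Bplus A -> exists f, [/\ A = graph f, symmap f, nonnegmap f
  & exists2 M : R, 0 < M & forall x, `|f x| <= (M%:C)%C * `|x|].
Proof.
move=> [[Asa A0] domA [M bM]].
have ex x : exists y, A (x, y) by have : dom A x by rewrite domA.
have [f hf] := choice ex.
have [lA _ _] := Asa.
exists f; split.
- apply/seteqP; split=> -[x y] /=; first by move=> Axy; apply: linop_fun lA Axy (hf x).
  by move=> /graphP ->.
- by move=> x y; apply: selfadjoint_sym Asa (hf x) (hf y).
- by move=> x; apply: A0.
- exists (`|M| + 1) => [|x]; first by rewrite ltr_wpDl.
  apply: (le_trans (bM _ _ (hf x))); apply: ler_wpM2r => //.
  by rewrite lecR (le_trans (ler_norm _))// lerDl.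
Qed.

(** If [u] is in the domain of the adjoint, then [<B x, f u> = <x, v>] for all [x]
    in [dom B]; that is, [f u] is in the domain of [adj B = B]. *)
Lemma adj_graph_mul f B : symmap f -> selfadjoint B ->
  adj (opmul (graph f) B) = opmul B (graph f).
Proof.
move=> fs Bsa; have [_ _ aB] := Bsa.
apply/seteqP; split=> -[u v].
  move=> h; exists (f u) => //; rewrite -aB => x y Bxy /=.
  by rewrite -fs; apply: h; exists y.
move=> [_ /graphP -> Bfu] x y [z /= Bxz /graphP ->].
by rewrite fs; apply: selfadjoint_sym Bsa Bxz Bfu.
Qed.

(** The graph of [a B], for [a] nonzero. *)
Definition opscale a B : set (H * H) := [set p | B (p.1, a^-1 *: p.2)].

Lemma opscale_nonneg_selfadjoint (M : R) B : 0 < M -> nonneg_selfadjoint B ->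
  nonneg_selfadjoint (opscale (M%:C)%C B).
Proof.
move=> M0 [Bsa B0]; set c := (M%:C)%C.
have cp : 0 < c by rewrite ltcR.
have cn : c != 0 by rewrite gt_eqF.
have cc : (c^-1)^* = c^-1 by rewrite conj_Creal// ger0_real// invr_ge0 ltW.
have [[Bz Bl Bf] dB aB] := Bsa.
have domB : dom (opscale c B) = dom B.
  apply/seteqP; split=> x [y Bxy]; first by exists (c^-1 *: y).
  by exists (c *: y); rewrite /opscale /= scalerA mulVf// scale1r.
split; last first.
  move=> x y /B0; rewrite ipZl pmulr_rge0// invr_gt0//.
split.
- split; first by rewrite /opscale /= scaler0.
    move=> a x y x' y' Bx Bx'; rewrite /opscale /= scalerDr !scalerA mulrC -scalerA.
    exact: Bl.
  by move=> x y y' Bx Bx'; apply: (scalerI (invr_neq0 cn)); apply: Bf Bx Bx'.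
- by rewrite domB.
apply/seteqP; split=> -[u v] h.
  rewrite /opscale /= -aB => x y Bxy /=; rewrite ipZr cc.
  have : opscale c B (x, c *: y) by rewrite /opscale /= scalerA mulVf// scale1r.
  by move=> /h /= <-; rewrite ipZl mulrA mulVf// mul1r.
move=> x y Bxy /=.
have := selfadjoint_sym Bsa Bxy h; rewrite /= ipZl ipZr cc.
by move=> /(mulfI (invr_neq0 cn)).
Qed.

Lemma symmapZ f a x : symmap f -> f (a *: x) = a *: f x.
Proof.
by move=> fs; have := symmap_linear a x 0 fs; rewrite (symmap0 fs) !addr0.
Qed.

Lemma opscale_graph_mul (M : R) f B : 0 < M -> symmap f ->
  opmul (graph f) B =
  opmul (graph (fun x => (M%:C)%C^-1 *: f x)) (opscale (M%:C)%C B).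
Proof.
move=> M0 fs; have cn : (M%:C)%C != 0 by rewrite gt_eqF// ltcR.
apply/seteqP; split=> -[x z] [y /= Bxy /graphP ->].
  exists ((M%:C)%C *: y); rewrite /opscale /graph /= ?(symmapZ _ _ fs) scalerA mulVf//.
    by rewrite scale1r.
  by rewrite scale1r.
by exists ((M%:C)%C^-1 *: y) => //; rewrite /graph /= (symmapZ _ _ fs).
Qed.

Lemma graph_comp f g : opmul (graph f) (graph g) = graph (f \o g).
Proof.
apply/seteqP; split=> -[x z] /=; first by move=> [y /graphP -> /= /graphP ->].
by move=> e; exists (g x).
Qed.

(** The solution is [Y = M B], where [M > 0] bounds the norm of [A]: then
    [T = (A / M) Y] with [A / M] a contraction [k], whose square root is [r]. *)
Lemma ople_of_Ll2plus T : linop T -> closed T -> dense (dom T) -> Ll2plus T ->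
  exists Y : set (H * H),
    [/\ nonneg_selfadjoint Y,
        ople (opmul (adj T) T) (opmul (adj T) Y) /\
          opmul (adj T) Y = opmul Y T,
        selfadjoint (opmul (adj T) Y)
      & dom T `<=` dom Y /\ dom Y `<=` dom (opsqrt (opmul (adj T) Y))].
Proof.
move=> lT cT dT [_ _ [A [B [/Bplus_graph [f [-> fs f0 [M M0 fM]]] Bsa TAB]]]].
have c0 : 0 < (M%:C)%C^-1 :> C by rewrite invr_gt0 ltcR.
have cc : ((M%:C)%C^-1 : C)^* = (M%:C)%C^-1 by rewrite conj_Creal// ger0_real// ltW.
move: TAB; rewrite (opscale_graph_mul _ M0 fs).
set k := fun x => _; set Y := opscale _ _ => TE.
have Ysa : nonneg_selfadjoint Y by apply: opscale_nonneg_selfadjoint.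
have ks : symmap k by move=> x z; rewrite /k ipZl ipZr fs cc.
have k0 : nonnegmap k by move=> x; rewrite /k ipZl mulr_ge0// ltW.
have k1 x : ip (k x) x <= ip x x.
  rewrite (ge0_complexE (k0 x)) (ge0_complexE (ip_ge0 x)) lecR.
  apply: contraction_form_le => z.
  by rewrite normrZ gtr0_norm// ler_pdivrMl ?ltcR// fM.
have [r [rs r0 rc rr _]] := bounded_sqrt_exists ks k0 k1.
have [lY _ _] := Ysa.1.
pose C1 := opmul (graph r) Y.
have domC1 : dom C1 = dom Y.
  apply/seteqP; split=> x; first by move=> [t [y /= Yxy _]]; exists y.
  by move=> [y Yxy]; exists (r y), y.
have domT : dom T = dom Y.
  rewrite TE; apply/seteqP; split=> x; first by move=> [t [y /= Yxy _]]; exists y.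
  by move=> [y Yxy]; exists (k y), y.
have lC1 : linop C1.
  have [Y0 Yl Yf] := lY; split.
  - by exists 0; rewrite // /graph /= (symmap0 rs).
  - move=> a x y x' y' [z /= Yz /graphP ->] [z' /= Yz' /graphP ->].
    exists (a *: z + z').
      exact: Yl.
    by rewrite /graph /= (symmap_linear _ _ _ rs).
  - move=> x y y' [z /= Yz /graphP ->] [z' /= Yz' /graphP ->].
    by rewrite (Yf _ _ _ Yz Yz').
have dC1 : dense (dom C1) by rewrite domC1 -domT.
have rB x y : r (x - y) = r x - r y := symmapB rs x y.
(* If [v n = r (w n)] tends to [y], then [k (w n) = r (v n)] tends to [r y], so
   [r y = k b = r (r b)] with [b = Y x] because [T] is closed. The vector
   [y - r b] is in the kernel of [r] and in the closure of the range of [r],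
   so it is 0. *)
have cC1 : closed C1.
  apply: closed_seq => u v x y Cuv ux vy.
  have [w hw] := choice (fun n => let: ex_intro2 z h1 h2 := Cuv n in
    ex_intro (fun z => Y (u n, z) /\ v n = r z) z (conj h1 h2)).
  have rv : r (v n) @[n --> \oo] --> r y.
    apply: (@cvg_dominated _ _ _ _ (fun n => v n - y)).
      by move=> n; rewrite -rB; apply: rc.
    exact/subr_cvg0.
  have : T (x, r y).
    apply: closed_seqP cT _ ux rv => n; rewrite TE; have [Yn ->] := hw n.
    by exists (w n) => //; rewrite /graph /= rr.
  rewrite TE => -[b /= Yxb]; rewrite /graph /= -rr => e.
  exists b => //; rewrite /graph /=.
  have re : r (y - r b) = 0 by rewrite rB e subrr.
  apply/eqP; rewrite -subr_eq0; apply/eqP/ip_eq0.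
  rewrite ipBr -[X in _ - X]rs re ip0l subr0.
  apply: (@seq_lim_unique R C^o (fun n => ip (y - r b) (v n) : C^o)).
    by apply: cvg_ip => //; apply: cvg_cst.
  have -> : (fun n => ip (y - r b) (v n) : C^o) = (fun=> 0).
    by apply/funext => n; have [_ ->] := hw n; rewrite -rs re ip0l.
  exact: cvg_cst.
have adjT : adj T = opmul Y (graph k) by rewrite TE adj_graph_mul//; case: Ysa.
have adjC1 : adj C1 = opmul Y (graph r) by rewrite adj_graph_mul//; case: Ysa.
have TY : opmul (adj T) Y = opmul (adj C1) C1.
  rewrite adjT adjC1 /C1 -!opmulA [opmul (graph r) (opmul _ _)]opmulA graph_comp.
  by congr (opmul _ (opmul (graph _) _)); apply/funext => x /=; rewrite rr.
have TYsa := adjmul_selfadjoint lC1 cC1 dC1.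
have [C1D DC1] := opsqrt_polar lC1 cC1 dC1.
exists Y; split=> //.
- split; last by rewrite adjT TE opmulA.
  split; first exact: adjmul_selfadjoint.
  + by rewrite TY.
  + rewrite TY => x [s /DC1 [c [y /= Yxy _] _]].
    have : T (x, k y) by rewrite TE; exists y.
    by move=> /(opsqrt_polar lT cT dT).1 [s' ? _]; exists s'.
  + rewrite TY => x t s Dxt Dxs.
    have [c C1x <-] := DC1 _ _ Dxs; have [y /= Yxy /graphP e] := C1x.
    have Txy : T (x, k y) by rewrite TE; exists y.
    rewrite (opsqrt_polar_norm lT cT dT Txy Dxt) e -rr; exact: rc.
- by rewrite TY; case: TYsa.
- split; first by rewrite domT.
  rewrite -domC1 TY => x [c /C1D [s ? _]]; by exists s.
Qed.

Lemma Ll2plus_of_ople T Y : linop T -> closed T -> dense (dom T) ->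
  nonneg_selfadjoint Y -> ople (opmul (adj T) T) (opmul (adj T) Y) ->
  opmul (adj T) Y = opmul Y T ->
  dom T `<=` dom Y -> dom Y `<=` dom (opsqrt (opmul (adj T) Y)) -> Ll2plus T.
Proof.
move=> lT cT dT Ysa [_ _ domle normle] YT domTY domYS.
move: normle domle domYS; set S := opsqrt (opmul (adj T) Y) => normle domle domYS.
have [lY _ _] := Ysa.1.
have [Ssa SS] : nonneg_selfadjoint S /\ opmul S S = opmul (adj T) Y.
  by apply: (@opsqrt_dom_nonempty _ 0); apply: domYS; exists 0; case: lY.
have [lS dS aS] := Ssa.1; have cS := selfadjoint_closed Ssa.1.
have [polT Tpol] := opsqrt_polar lT cT dT.
have domST : dom S `<=` dom T.
  by move=> x /domle [t /Tpol [y Txy _]]; exists y.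
have TS x t s : T (x, t) -> S (x, s) -> `|t| <= `|s|.
  move=> Txt Sxs; have [s' Kxs' <-] := polT _ _ Txt.
  exact: normle Kxs' Sxs.
(* The identity <T x, Y u> = <S x, S u>, first on the core dom (S S). *)
have form x t s u y s' : T (x, t) -> S (x, s) -> Y (u, y) -> S (u, s') ->
    ip t y = ip s s'.
  move=> Txt Sxs Yuy Sus'.
  have [un [vn [wn [Sn aSn uncv vncv]]]] := adjmul_core lS cS Sxs.
  have ex n : exists tn, T (un n, tn) /\ Y (tn, wn n).
    have : opmul S S (un n, wn n).
      by exists (vn n); [exact: Sn | rewrite -aS; exact: aSn].
    by rewrite SS YT => -[tn ? ?]; exists tn.
  have [tn htn] := choice ex.
  have tncv : tn n @[n --> \oo] --> t.
    apply: (@cvg_dominated _ _ _ _ (fun n => vn n - s)); last exact/subr_cvg0.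
    by move=> n; apply: TS (linopB lT (htn n).1 Txt) (linopB lS (Sn n) Sxs).
  apply: (@seq_lim_unique R C^o (fun n => ip (tn n) y : C^o)).
    by apply: cvg_ip => //; apply: cvg_cst.
  have -> : (fun n => ip (tn n) y : C^o) = (fun n => ip (vn n) s').
    apply/funext => n.
    by rewrite -(selfadjoint_sym Ysa.1 (htn n).2 Yuy) -(adj_ip (aSn n) Sus').
  by apply: cvg_ip => //; apply: cvg_cst.
pose M : set (H * H) := [set p | exists x, S (x, p.1) /\ T (x, p.2)].
have Ml : lin_subspace M.
  have [S0 Sl _] := lS; have [T0 Tl _] := lT; split; first by exists 0.
  move=> a [s1 t1] [s2 t2] [x1 [/= S1 T1]] [x2 [/= S2 T2]].
  by exists (a *: x1 + x2); split; [apply: Sl | apply: Tl].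
have Mle s t : M (s, t) -> `|t| <= `|s| by move=> [x [/= Sx Tx]]; apply: TS Tx Sx.
have exVW h : exists p : H * H, (exists u v : nat -> H,
    [/\ forall n, M (u n, v n), u n @[n --> \oo] --> p.1 & v n @[n --> \oo] --> p.2])
    /\ forall s t, M (s, t) -> ip s p.1 = ip t h.
  have [u [v [x [y [Muv ux vy orth]]]]] := riesz_dominated h Ml Mle.
  by exists (x, y); split=> //; exists u, v.
have [WA hWA] := choice exVW.
(* [W] is the adjoint of the contraction [S x |-> T x], extended by 0 to the
   orthogonal complement of the range of [S], and [A h] is the value of that
   contraction at [W h]. *)
pose W h := (WA h).1; pose A h := (WA h).2.
have AW h k : ip (A h) k = ip (W h) (W k).
  have [[u [v [Muv ux vy]]] _] := hWA h; have [_ orth] := hWA k.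
  apply: (@seq_lim_unique R C^o (fun n => ip (v n) k : C^o)).
    by apply: cvg_ip => //; apply: cvg_cst.
  under eq_fun do rewrite -(orth _ _ (Muv _)).
  by apply: cvg_ip => //; apply: cvg_cst.
have AleW h : `|A h| <= `|W h|.
  have [[u [v [Muv ux vy]]] _] := hWA h.
  by apply: seq_lim_norm_mono ux vy _ => n; apply: Mle.
have Ac h : `|A h| <= `|h|.
  apply: (le_trans (AleW h)).
  have [->|W0] := eqVneq (W h) 0; first by rewrite normr0.
  have Wp : 0 < `|W h| by rewrite normr_gt0.
  rewrite -(ler_pM2l Wp) -expr2 ip_norm -[leLHS]ger0_norm ?ip_ge0// -AW.
  by rewrite (le_trans (ip_CauchySchwarz _ _))// ler_wpM2r.
have AY x y t : Y (x, y) -> T (x, t) -> A y = t.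
  move=> Yxy Txt; have [s Sxs] : dom S x by apply: domYS; exists y.
  have [[u [v [Muv ux vy]]] orth] := hWA y.
  (* Both [W y] and [S x] are in the closure of the range of [S] and have the
     same inner products with this range. *)
  have Ws : W y = s.
    apply/eqP; rewrite -subr_eq0; apply/eqP/ip_eq0.
    apply: (@seq_lim_unique R C^o (fun n => ip (u n - s) (W y - s) : C^o)).
      apply: cvg_ip; last exact: cvg_cst.
      by apply: cvgB => //; apply: cvg_cst.
    have -> : (fun n => ip (u n - s) (W y - s) : C^o) = (fun=> 0).
      apply/funext => n.
      have Mn : M (u n - s, v n - t).
        have [z [Sz Tz]] := Muv n; exists (z - x).
        by split; [apply: linopB lS Sz Sxs | apply: linopB lT Tz Txt].
      rewrite ipBr (orth _ _ Mn); have [z [Sz Tz]] := Mn.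
      by rewrite (form _ _ _ _ _ _ Tz Sz Yxy Sxs) subrr.
    exact: cvg_cst.
  apply: (@seq_lim_unique R H v) => //.
  apply: (@cvg_dominated _ _ _ _ (fun n => u n - s)).
    move=> n; have [z [Sz Tz]] := Muv n.
    by apply: TS (linopB lT Tz Txt) (linopB lS Sz Sxs).
  by rewrite -Ws; apply/subr_cvg0.
split=> //; exists (graph A), Y; split=> //.
  apply: graph_Bplus => // [h k | h].
    by rewrite AW [RHS]ipC AW -ipC.
  by rewrite /nonnegmap AW ip_ge0.
apply/seteqP; split=> -[x t] /=.
  move=> Txt; have [y Yxy] : dom Y x by apply: domTY; exists t.
  by exists y => //; rewrite /graph /= (AY _ _ _ Yxy Txt).
move=> [y /= Yxy /graphP ->].
have [t' Txt'] : dom T x by apply/domST/domYS; exists y.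
by rewrite (AY _ _ _ Yxy Txt').
Qed.

End Factorization.

Theorem theorem2p12 (R : realType) (H : hilbertType R) (T : set (H * H))
    (linT : linop T) (closedT : closed T) (denseT : dense (dom T)) :
  Ll2plus T <->
  exists Y : set (H * H),
    [/\ nonneg_selfadjoint Y,
        ople (opmul (adj T) T) (opmul (adj T) Y) /\
          opmul (adj T) Y = opmul Y T,
        selfadjoint (opmul (adj T) Y)
      & dom T `<=` dom Y /\ dom Y `<=` dom (opsqrt (opmul (adj T) Y))].
Proof.
split; first exact: ople_of_Ll2plus.
by move=> [Y [Ysa [le_TY eqYT] _ [domTY domYS]]]; apply: (@Ll2plus_of_ople _ _ T Y).
Qed.
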